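(* Let $(A,B)$ be a Golay pair of length $g$ and let $(C,D)$ be a periodic Golay pair of length $v$. Define $$E(z)=\tfrac12[A(z)+B(z)]\,C(z^g)+\tfrac12[A(z)-B(z)]\,D(z^{-g})\,z^{gv-g},$$ $$F(z)=\tfrac12[B(z)-A(z)]\,C(z^{-g})\,z^{gv-g}+\tfrac12[A(z)+B(z)]\,D(z^g).$$ Then the pair $(E,F)$ given by these formulas is a periodic Golay pair of length $gv$.
   Context: A binary sequence of length $v$ is a sequence $A=[a_0,\ldots,a_{v-1}]$ with all $a_i\in\{1,-1\}$. To each binary sequence $A$ of length $v$ one associates the polynomial $A(z)=a_0+a_1z+\cdots+a_{v-1}z^{v-1}$ in the indeterminate $z$, and a sequence is identified with its polynomial; thus $(E,F)$ denotes the pair of sequences of length $gv$ whose terms are the coefficients of $z^0,\ldots,z^{gv-1}$ in $E(z)$ and $F(z)$. A pair $(A,B)$ of binary sequences of length $g$ is a Golay pair if the sum of their aperiodic autocorrelations vanishes at all nonzero shifts, i.e. $\sum_{j=0}^{g-1-s}(a_ja_{j+s}+b_jb_{j+s})=0$ for $1\le s\le g-1$; equivalently $A(z)A(z^{-1})+B(z)B(z^{-1})=2g$. The periodic autocorrelation function of a binary sequence $A$ of length $v$ is $\mathrm{PAF}_A(s)=\sum_{j=0}^{v-1}a_{j+s}a_j$ for $s\in\mathbb{Z}_v=\mathbb{Z}/v\mathbb{Z}$, with indices computed modulo $v$. A pair $(A,B)$ of binary sequences of length $v$ is a periodic Golay pair if $\mathrm{PAF}_A(s)+\mathrm{PAF}_B(s)=0$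 for all $s\neq0$ in $\mathbb{Z}_v$. *)

(* Defs.v *)
From mathcomp Require Import all_boot all_order all_algebra.

Set Implicit Arguments.
Unset Strict Implicit.
Unset Printing Implicit Defensive.

Import GRing.Theory.
Local Open Scope ring_scope.

Definition binary (v : nat) (A : v.-tuple int) : Prop :=
  forall i : 'I_v, tnth A i = 1 \/ tnth A i = -1.

Definition aperiodic_autocorr (v : nat) (A : v.-tuple int) (s : nat) : int :=
  \sum_(j < v - s) A`_j * A`_(j + s).

Definition golay_pair (g : nat) (A B : g.-tuple int) : Prop :=
  [/\ binary A, binary B &
    forall s : nat, (0 < s < g)%N ->
      aperiodic_autocorr A s + aperiodic_autocorr B s = 0].

(* The periodic autocorrelation depends on s only modulo v; the nonzero
   classes of Z/vZ are represented below by the integers 0 < s < v. *)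
Definition PAF (v : nat) (A : v.-tuple int) (s : nat) : int :=
  \sum_(j < v) A`_((j + s) %% v) * A`_j.

Definition periodic_golay_pair (v : nat) (A B : v.-tuple int) : Prop :=
  [/\ binary A, binary B &
    forall s : nat, (0 < s < v)%N -> PAF A s + PAF B s = 0].

(* Laurent polynomials in z with rational coefficients are handled inside the
   field of rational functions Q(z), where substituting z^-g makes sense. *)
Notation ratfun := {fraction {poly rat}}.

Definition zvar : ratfun := tofrac 'X.

(* A(t) = a_0 + a_1 t + ... + a_(v-1) t^(v-1); distinct sequences of the same
   length have distinct values at t = zvar. *)
Definition seq_eval (v : nat) (A : v.-tuple int) (t : ratfun) : ratfun :=
  \sum_(i < v) (A`_i)%:~R * t ^+ i.

(* Main.v *)
Require Import Defs.
From mathcomp Require Import all_boot all_order all_algebra.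
From mathcomp Require Import ring zify.

(** Write [P = (A + B) / 2] and [Q = (A - B) / 2].  At every position one of
    [P], [Q] is [1] or [-1] and the other is [0], because [A] and [B] are
    binary.  Cutting a sequence of length [g * v] into [v] blocks of length
    [g], the formulas for [E] and [F] say that entry [i] of block [j] is
<<
      E(i, j) =   P_i c_j     + Q_i d_(v-1-j)
      F(i, j) = - Q_i c_(v-1-j) + P_i d_j
>>
    so [E] and [F] are binary.

    A shift by [s] moves the entry [i] of a block to the entry
    [i' = (i + s) %% g] of the block [t = (i + s) %/ g] places further on,
    cyclically.  Fix [i] and sum the products over all blocks [j].  The mixed
    terms pairing [C] with [D] cancel between [E] and [F] under the reflection
    of the cyclic group of blocks exchanging [j] and [v - 1 - (j + t)]
    ([reflected_correlation]), and what is left is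
    [(P_i' P_i + Q_i' Q_i) * (PAF C t + PAF D t)] ([PAF_interleave]).  The first
    factor is half of [A_i' A_i + B_i' B_i].

    As [i] varies, [t] takes the value [s %/ g] when [i + s %% g] stays
    inside the block, and the value [s %/ g + 1] when it does not
    ([sum_wrap]).  If [g] does not divide [s], the coefficients of these two
    values are half the sums of the aperiodic autocorrelations of [A] and [B] at
    [s %% g] and at [g - s %% g]; both vanish since [(A, B)] is a Golay pair.
    If [g] divides [s], only [t = s %/ g] occurs, it lies strictly between [0]
    and [v], and [PAF C t + PAF D t = 0] by hypothesis. *)

Set Implicit Arguments.
Unset Strict Implicit.
Unset Printing Implicit Defensive.

Import GRing.Theory.
Local Open Scope ring_scope.

(** The matrix [[p, q; -q, p]] applied to [c], [d] twisted by the reflection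
    [j |-> u - j] multiplies the sum of the autocorrelations by a scalar.  The
    involution [j |-> u - (j + t)] preserves the set of products of two terms
    [t] apart: it exchanges the two mixed terms with coefficient [p' * q], as
    well as the two with coefficient [q' * p], and each pair occurs with
    opposite signs; it also turns the reflected pure terms back into the
    plain ones. *)
Lemma reflected_correlation (R : comPzRingType) (G : finZmodType)
    (c d : G -> R) (p q p' q' : R) (u t : G) :
  \sum_j ((p' * c (j + t) + q' * d (u - (j + t))) * (p * c j + q * d (u - j))
        + (p' * d (j + t) - q' * c (u - (j + t))) * (p * d j - q * c (u - j)))
  = (p' * p + q' * q) * \sum_j (c (j + t) * c j + d (j + t) * d j).
Proof.
have refl (h : G -> R) : \sum_j h j = \sum_j h (u - (j + t)).
  rewrite (reindex_inj (h := fun j => u - (j + t))) //.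
  by move=> j1 j2 /addrI /oppr_inj /addIr.
have sub1 (j : G) : u - (j + t) + t = u - j by rewrite opprD -!addrA addNr addr0.
have sub2 (j : G) : u - (u - (j + t)) = j + t by rewrite opprB addrCA subrr addr0.
have sub3 (j : G) : u - (u - j) = j by rewrite opprB addrCA subrr addr0.
(* The four kinds of products; their values at [u - (j + t)] are the
   products that the expansion contains besides them. *)
set cc := fun j => c (j + t) * c j.
set dd := fun j => d (j + t) * d j.
set cd := fun j => c (j + t) * d (u - j).
set dc := fun j => d (u - (j + t)) * c j.
transitivity (\sum_j ((p' * p) * (cc j + dd j)
  + (q' * q) * (cc (u - (j + t)) + dd (u - (j + t)))
  + (p' * q) * (cd j - cd (u - (j + t)))
  + (q' * p) * (dc j - dc (u - (j + t))))).
  apply: eq_bigr => j _; rewrite /cc /dd /cd /dc sub1 sub2 sub3; ring.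
rewrite !big_split /= -!mulr_sumr !sumrB -!refl !subrr !mulr0 !addr0.
by rewrite !big_split /= -!refl; ring.
Qed.

(** Reading the blocks backwards is the reflection [j |-> -1 - j] of the cyclic
    group ['I_n.+1], where [ord_max] is the class of [-1]. *)
Lemma rev_ordE n (j : 'I_n.+1) : rev_ord j = ord_max - j.
Proof.
apply: (addIr j); rewrite subrK; apply: val_inj => /=.
by rewrite subSS subnK -1?ltnS // modn_small.
Qed.

Lemma sum_ord_blocks (M : nmodType) g v (f : nat -> M) :
  \sum_(k < g * v) f k = \sum_(i < g) \sum_(j < v) f (i + g * j)%N.
Proof.
rewrite exchange_big; elim: v => [|v IHv]; first by rewrite muln0 !big_ord0.
rewrite mulnSr big_split_ord big_ord_recr /= -IHv; congr (_ + _).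
by apply: eq_bigr => i _; rewrite addnC.
Qed.

(** The sequence with polynomial
    [P(z) C(z^g) + Q(z) D(z^-g) z^(gv-g)]: the factor [z^(gv-g)] makes the
    blocks of [D] appear in reverse order, hence the index
    [v.-1 - k %/ g]. *)
Definition interleave g v (P Q : g.-tuple int) (C D : v.-tuple int) :
    (g * v).-tuple int :=
  [tuple P`_(k %% g) * C`_(k %/ g) + Q`_(k %% g) * D`_(v.-1 - k %/ g)
  | k < g * v].

Lemma nth_interleave g v (P Q : g.-tuple int) (C D : v.-tuple int) i j :
  (i < g)%N -> (j < v)%N ->
  (interleave P Q C D)`_(i + g * j) = P`_i * C`_j + Q`_i * D`_(v.-1 - j).
Proof.
move=> ig jv; have kgv : (i + g * j < g * v)%N by nia.
rewrite -[(i + _)%N]/(nat_of_ord (Ordinal kgv)) -tnth_nth tnth_mktuple /=.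
have g0 : (0 < g)%N by lia.
by rewrite mulnC addnC modnMDl divnMDl // modn_small // divn_small // addn0.
Qed.

Lemma nth_interleave_mod g v (P Q : g.-tuple int) (C D : v.-tuple int) k :
  (0 < g)%N -> (0 < v)%N ->
  (interleave P Q C D)`_(k %% (g * v)) =
    P`_(k %% g) * C`_((k %/ g) %% v) + Q`_(k %% g) * D`_(v.-1 - (k %/ g) %% v).
Proof.
move=> g0 v0; rewrite -nth_interleave ?ltn_mod //; congr (_`_ _).
rewrite {1}(divn_eq k g) {1}(divn_eq (k %/ g) v) mulnDl -addnA -mulnA.
rewrite [(v * g)%N]mulnC modnMDl modn_small; first by lia.
by have := ltn_pmod k g0; have := ltn_pmod (k %/ g) v0; nia.
Qed.

Lemma seq_eval_interleave g v (P Q : g.-tuple int) (C D : v.-tuple int) (t : ratfun) :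
  t != 0 ->
  seq_eval (interleave P Q C D) t =
    seq_eval P t * seq_eval C (t ^+ g)
    + seq_eval Q t * seq_eval D (t ^- g) * t ^+ (g * v - g).
Proof.
move=> t0; rewrite /seq_eval.
rewrite (sum_ord_blocks g v (fun k => ((interleave P Q C D)`_k)%:~R * t ^+ k)).
rewrite -mulrA !mulr_suml -big_split; apply: eq_bigr => i _ /=.
rewrite [X in _ = _ + _ * X](reindex_inj rev_ord_inj) !mulr_sumr -big_split.
apply: eq_bigr => j _ /=.
rewrite nth_interleave // rmorphD !rmorphM /= exprD exprM mulrDl.
have -> : (v - j.+1 = v.-1 - j)%N by lia.
have -> : t ^+ (g * v - g) = (t ^+ g) ^+ (v.-1 - j) * (t ^+ g) ^+ j.
  by rewrite -!exprM -exprD; congr (_ ^+ _); have := ltn_ord j; nia.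
have tg0 : (t ^+ g) ^+ (v.-1 - j) != 0 by rewrite !expf_neq0.
rewrite exprVn -(mulrA (D`_(v.-1 - j))%:~R) mulKf // mulrACA; congr (_ + _).
by rewrite mulrACA.
Qed.

(** The quotients are exact on binary sequences, the only ones they are
    applied to. *)
Definition half_sum g (A B : g.-tuple int) : g.-tuple int :=
  [tuple ((tnth A i + tnth B i) %/ 2)%Z | i < g].

Definition half_diff g (A B : g.-tuple int) : g.-tuple int :=
  [tuple ((tnth A i - tnth B i) %/ 2)%Z | i < g].

Lemma half_sumE g (A B : g.-tuple int) (binA : binary A) (binB : binary B)
    (i : 'I_g) :
  2 * (half_sum A B)`_i = A`_i + B`_i.
Proof.
rewrite -!tnth_nth tnth_mktuple.
by have [->|->] := binA i; have [->|->] := binB i.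
Qed.

Lemma half_diffE g (A B : g.-tuple int) (binA : binary A) (binB : binary B)
    (i : 'I_g) :
  2 * (half_diff A B)`_i = A`_i - B`_i.
Proof.
rewrite -!tnth_nth tnth_mktuple.
by have [->|->] := binA i; have [->|->] := binB i.
Qed.

(** Exactly one of [half_sum A B] and [half_diff A B] is nonzero at each
    position, so exactly one of the two terms of each entry survives. *)
Lemma binary_interleave g v (A B : g.-tuple int) (C D : v.-tuple int) :
  binary A -> binary B -> binary C -> binary D ->
  binary (interleave (half_sum A B) (half_diff A B) C D).
Proof.
move=> binA binB binC binD k.
have g0 : (0 < g)%N by case: (g) k => [[]|].
have im : (k %% g < g)%N by rewrite ltn_mod.
have jm : (k %/ g < v)%N by rewrite ltn_divLR // [X in (_ < X)%N]mulnC.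
have jm' : (v.-1 - k %/ g < v)%N by rewrite (leq_ltn_trans (leq_subr _ _)) // ltn_predL (leq_ltn_trans _ jm).
rewrite tnth_mktuple.
have := half_sumE binA binB (Ordinal im).
have := half_diffE binA binB (Ordinal im).
rewrite -[(A)`_ _]tnth_nth -[(B)`_ _]tnth_nth.
rewrite -[(C)`_ _](tnth_nth _ _ (Ordinal jm)).
rewrite -[(D)`_ _](tnth_nth _ _ (Ordinal jm')) /=.
have [->|->] := binA (Ordinal im); have [->|->] := binB (Ordinal im);
have [->|->] := binC (Ordinal jm); have [->|->] := binD (Ordinal jm'); lia.
Qed.

Lemma two_ratfun_neq0 : (2 : ratfun) != 0.
Proof. by rewrite -tofrac1 -tofracMn tofrac_eq0 -polyC_natr polyC_eq0. Qed.

Lemma seq_eval_half_sum g (A B : g.-tuple int) t :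
  binary A -> binary B ->
  seq_eval (half_sum A B) t = 2^-1 * (seq_eval A t + seq_eval B t).
Proof.
move=> binA binB; apply: (mulfI two_ratfun_neq0).
rewrite mulVKf ?two_ratfun_neq0 // /seq_eval -big_split mulr_sumr.
apply: eq_bigr => i _ /=.
by rewrite -mulrDl -rmorphD /= -half_sumE // rmorphM mulrA.
Qed.

Lemma seq_eval_half_diff g (A B : g.-tuple int) t :
  binary A -> binary B ->
  seq_eval (half_diff A B) t = 2^-1 * (seq_eval A t - seq_eval B t).
Proof.
move=> binA binB; apply: (mulfI two_ratfun_neq0).
rewrite mulVKf ?two_ratfun_neq0 // /seq_eval -sumrB mulr_sumr.
apply: eq_bigr => i _ /=.
by rewrite -mulrBl -rmorphB /= -half_diffE // rmorphM mulrA.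
Qed.

(** The block-by-block form of [PAF]: for a fixed position [i] in the blocks,
    the sum over the blocks is an instance of [reflected_correlation] in the
    cyclic group of order [v]. *)
Lemma PAF_interleave g v (P Q Q' : g.-tuple int) (C D : v.-tuple int) s :
  (forall i : 'I_g, Q'`_i = - Q`_i) ->
  PAF (interleave P Q C D) s + PAF (interleave P Q' D C) s =
  \sum_(i < g) (P`_((i + s) %% g) * P`_i + Q`_((i + s) %% g) * Q`_i)
               * (PAF C ((i + s) %/ g) + PAF D ((i + s) %/ g)).
Proof.
(* The cyclic group ['I_n.+1] requires at least one block. *)
case: v C D => [|n] C D Q'E.
  rewrite /PAF -big_split /= [LHS]big1 => [|[k]]; last by rewrite muln0.
  by rewrite big1 // => i _; rewrite !big_ord0 addr0 mulr0.
rewrite /PAF -big_split /=.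
pose e (T : (g * n.+1).-tuple int) k := T`_((k + s) %% (g * n.+1)) * T`_k.
rewrite (sum_ord_blocks g n.+1 (fun k => e (interleave P Q C D) k
   + e (interleave P Q' D C) k)).
apply: eq_bigr => i _; have g0 : (0 < g)%N by case: (g) i => [[]|].
set i' := ((i + s) %% g)%N; set t := ((i + s) %/ g)%N.
pose c (j : 'I_n.+1) := C`_j; pose d (j : 'I_n.+1) := D`_j.
have shift (j : 'I_n.+1) : ((j + t) %% n.+1)%N = (j + inZp t)%R :> nat.
  by rewrite /= modnDmr.
have refl (j : 'I_n.+1) : (n - j)%N = (ord_max - j)%R :> nat.
  by rewrite -rev_ordE /= subSS.
have Q'i' : Q'`_i' = - Q`_i' by rewrite (Q'E (Ordinal (ltn_pmod (i + s) g0))).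
rewrite -big_split; under [in RHS]eq_bigr => j _ do rewrite shift.
rewrite -[RHS](reflected_correlation c d _ _ _ _ ord_max).
apply: eq_bigr => j _; rewrite /e.
rewrite !nth_interleave_mod // !nth_interleave //.
have -> : ((i + g * j + s) %% g = i')%N by rewrite addnAC mulnC addnC modnMDl.
have -> : ((i + g * j + s) %/ g = j + t)%N by rewrite addnAC mulnC addnC divnMDl.
by rewrite shift !refl Q'E Q'i' !mulNr.
Qed.

(** A shift by [s0 + g * s1] advances the first [g - s0] positions of a block
    by [s1] blocks and the last [s0] positions, which wrap around, by
    [s1.+1]. *)
Lemma sum_wrap (R : pzSemiRingType) g s0 s1 (f : nat -> nat -> R) (w : nat -> R) :
  (s0 < g)%N ->
  \sum_(i < g) f ((i + (s0 + g * s1)) %% g)%N i * w ((i + (s0 + g * s1)) %/ g)%N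
  = (\sum_(i < g - s0) f (i + s0)%N i) * w s1
    + (\sum_(i < s0) f i (i + (g - s0))%N) * w s1.+1.
Proof.
move=> s0g; have g0 : (0 < g)%N by lia.
pose h i := f ((i + (s0 + g * s1)) %% g)%N i * w ((i + (s0 + g * s1)) %/ g)%N.
have hE i t r : (i + (s0 + g * s1) = t * g + r)%N -> (r < g)%N -> h i = f r i * w t.
  by rewrite /h => -> rg; rewrite modnMDl divnMDl // modn_small // divn_small // addn0.
rewrite -[LHS](big_mkord xpredT h) (big_cat_nat (n := (g - s0)%N)) ?leq_subr //=.
rewrite big_mkord -[X in \big[_/_]_(X <= _ < _) _]add0n big_addn subKn ?(ltnW s0g) // big_mkord.
rewrite !mulr_suml; congr (_ + _); apply: eq_bigr => i _; have ilt := ltn_ord i.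
  by apply: hE; lia.
by apply: hE; lia.
Qed.

Theorem proposition3 (g v : nat)
    (A B : g.-tuple int) (C D : v.-tuple int)
    (hAB : golay_pair A B) (hCD : periodic_golay_pair C D) :
  let z := zvar in
  exists E F : (g * v).-tuple int,
    [/\ seq_eval E z =
          2^-1 * (seq_eval A z + seq_eval B z) * seq_eval C (z ^+ g)
          + 2^-1 * (seq_eval A z - seq_eval B z) * seq_eval D (z ^- g)
              * z ^+ (g * v - g),
        seq_eval F z =
          2^-1 * (seq_eval B z - seq_eval A z) * seq_eval C (z ^- g)
              * z ^+ (g * v - g)
          + 2^-1 * (seq_eval A z + seq_eval B z) * seq_eval D (z ^+ g)
      & periodic_golay_pair E F].
Proof.
move: hAB hCD => [binA binB golAB] [binC binD perCD] z.
have z0 : z != 0 by rewrite tofrac_eq0 polyX_eq0.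
exists (interleave (half_sum A B) (half_diff A B) C D).
exists (interleave (half_sum B A) (half_diff B A) D C).
split.
- by rewrite seq_eval_interleave // seq_eval_half_sum // seq_eval_half_diff.
- rewrite seq_eval_interleave // seq_eval_half_sum // seq_eval_half_diff //.
  by rewrite [LHS]addrC (addrC (seq_eval A z)).
split; [exact: binary_interleave | exact: binary_interleave |].
move=> s /andP[s_gt0 s_lt].
have g0 : (0 < g)%N by lia.
have sumC : half_sum B A = half_sum A B.
  by apply: eq_from_tnth => i; rewrite !tnth_mktuple addrC.
rewrite sumC PAF_interleave => [|i]; last first.
  have := half_diffE binA binB i; have := half_diffE binB binA i; lia.
pose w t := PAF C t + PAF D t.
pose f i' i := A`_i' * A`_i + B`_i' * B`_i.
(* Doubling twice clears the denominators of the half sum and half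
   difference: 4 (P_i' P_i + Q_i' Q_i) = 2 (A_i' A_i + B_i' B_i). *)
suff : \sum_(i < g) f ((i + s) %% g)%N i * w ((i + s) %/ g)%N = 0.
  move=> sum0; apply: (@mulfI _ 2) => //; rewrite mulr0 -[RHS]sum0 mulr_sumr.
  apply: eq_bigr => i _; rewrite mulrA; congr (_ * _).
  set i' := Ordinal (ltn_pmod (i + s) g0).
  apply: (@mulfI _ 2) => //.
  have := half_sumE binA binB i; have := half_sumE binA binB i'.
  have := half_diffE binA binB i; have := half_diffE binA binB i'.
  by rewrite /f /=; nia.
have -> : s = (s %% g + g * (s %/ g))%N by rewrite mulnC addnC -divn_eq.
have s0g : (s %% g < g)%N by rewrite ltn_mod.
rewrite sum_wrap //; have [s0|s0] := posnP (s %% g).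
  (* Nothing wraps around, and the periodic pair is shifted by a nonzero
     class. *)
  rewrite s0 [X in _ + X * _]big_ord0 mul0r addr0 /w perCD ?mulr0 //; apply/andP.
  have := divn_eq s g; split; nia.
(* Both the part that wraps and the part that does not are sums of aperiodic
   autocorrelations of the Golay pair. *)
have fE t : (0 < t < g)%N -> \sum_(i < g - t) f (i + t)%N i = 0.
  move=> tg; rewrite -[RHS](golAB t tg) /aperiodic_autocorr -big_split.
  by apply: eq_bigr => i _; rewrite /f mulrC [B`_ _ * _]mulrC.
rewrite fE ?s0 // mul0r add0r.
have <- : \sum_(i < g - (g - s %% g)) f (i + (g - s %% g))%N i =
    \sum_(i < s %% g) f i (i + (g - s %% g))%N.
  rewrite subKn ?(ltnW s0g) //.
  by apply: eq_bigr => i _; rewrite /f mulrC [B`_ _ * _]mulrC.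
by rewrite fE ?mul0r //; lia.
Qed.
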